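(* Let $G$ be a connected $K_{1,5}$-free graph with $n$ vertices. If $\sigma_4(G)\geq n-1$, then $G$ contains a spanning tree $T$ with at most $5$ leaves and branch vertices in total, i.e. $|L(T)|+|B(T)|\leq 5$.
   Context: All graphs are finite and simple. $d(v)$ denotes the degree of $v$ in $G$. A set $X\subseteq V(G)$ is independent if no two vertices of $X$ are adjacent in $G$. For $k\geq 1$, $\sigma_k(G)=\min\{\sum_{i=1}^k d(v_i) : \{v_1,\ldots,v_k\}\text{ is an independent set of } k \text{ distinct vertices of } G\}$, with the convention $\sigma_k(G)=+\infty$ if $G$ has no independent set of size $k$. A graph is $K_{1,r}$-free if it does not contain $K_{1,r}$ as an induced subgraph. For a tree $T$, a leaf is a vertex of degree one in $T$ and a branch vertex is a vertex of degree at least three in $T$; $L(T)$ is the set of leaves and $B(T)$ is the set of branch vertices of $T$. *)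

(* Defs.v *)
From mathcomp Require Import all_boot.
Set Implicit Arguments.
Unset Strict Implicit.
Unset Printing Implicit Defensive.

Record sgraph (V : finType) := SGraph {
  adj :> rel V;
  adj_sym : symmetric adj;
  adj_irrefl : irreflexive adj }.

Section Graphs.
Variables (V : finType) (G : sgraph V).

Definition degree (v : V) : nat := #|[set u | G v u]|.

Definition independent (X : {set V}) : bool :=
  [forall x in X, forall y in X, ~~ G x y].

(* The graph without vertices is not connected, hence not a tree. *)
Definition connected : Prop := 0 < #|V| /\ forall x y : V, connect G x y.

(* Cycles of length 1 and 2 in the sense of [ucycle] are not graph cycles. *)
Definition acyclic : Prop := forall c : seq V, 2 < size c -> ~ ucycle G c.

Definition is_tree : Prop := connected /\ acyclic.

Definition leaves : {set V} := [set v | degree v == 1].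

Definition branch_vertices : {set V} := [set v | 3 <= degree v].

Definition degree_sum (X : {set V}) : nat := \sum_(v in X) degree v.

Definition independent_of_size (k : nat) (X : {set V}) : bool :=
  independent X && (#|X| == k).

(* [None] stands for +oo. *)
Definition sigma (k : nat) : option nat :=
  if [pick X | independent_of_size k X] is Some X0 then
    Some (degree_sum [arg min_(X < X0 | independent_of_size k X) degree_sum X])
  else None.

End Graphs.

(* [m <= s], where [s = None] stands for +oo. *)
Definition leq_inf (m : nat) (s : option nat) : bool :=
  if s is Some d then m <= d else true.

Lemma leq_inf_sigmaP (V : finType) (G : sgraph V) (k m : nat) :
  reflect (forall X, independent_of_size G k X -> m <= degree_sum G X)
          (leq_inf m (sigma G k)).
Proof.
rewrite /sigma; case: pickP => [X0 iX0 | no] /=.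
  case: arg_minnP => // X iX minX; apply: (iffP idP) => [le_m Y iY | H].
    exact: leq_trans le_m (minX Y iY).
  exact: H.
by apply: ReflectT => X; rewrite no.
Qed.

Definition induced_subgraph (U V : finType) (H : sgraph U) (G : sgraph V) :
    Prop :=
  exists2 f : U -> V, injective f & forall x y, G (f x) (f y) = H x y.

(* [None] is the centre of the star, the [Some i] are its leaves. *)
Definition star_rel (r : nat) : rel (option 'I_r) :=
  fun x y => isSome x != isSome y.

Lemma star_sym r : symmetric (@star_rel r).
Proof. by move=> x y; rewrite /star_rel eq_sym. Qed.

Lemma star_irrefl r : irreflexive (@star_rel r).
Proof. by move=> x; rewrite /star_rel eqxx. Qed.

Definition star (r : nat) : sgraph (option 'I_r) :=
  SGraph (@star_sym r) (@star_irrefl r).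

Definition star_free (r : nat) (V : finType) (G : sgraph V) : Prop :=
  ~ induced_subgraph (star r) G.

Definition spanning_tree (V : finType) (G T : sgraph V) : Prop :=
  subrel T G /\ is_tree T.

(* Main.v *)
From Stdlib Require Import Classical_Prop.
Require Import Defs.
From mathcomp Require Import all_boot zify.
Set Implicit Arguments.
Unset Strict Implicit.
Unset Printing Implicit Defensive.

(** A tree with |L| + |B| <= 5 is a spider with at most four legs: paths
    starting at a common centre and otherwise disjoint.  Suppose that a spider
    with the maximum number N of vertices is not spanning.  Its leg ends have no
    neighbours outside the spider, and cutting and reconnecting legs shows that
    they are independent.

    If some maximum spider has an empty leg, take the ends of its three other
    legs and an outside vertex w adjacent to the spider.  Otherwise take the
    four leg ends of a maximum spider whose first leg is as long as possible.
    In both cases the degree sum is at most n - 2.  To see this, add up along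
    each leg the numbers of chosen vertices adjacent to the vertices of the leg.
    The vertices with a positive number form runs separated by vertices with
    number 0; a run has excess at most 1 over its length, except at most one run
    per leg, of excess 2.  Here K_{1,5}-freeness bounds the number at a vertex,
    and makes the rest of the leg after a run of excess 2 a cycle.  With three
    legs, excess 2 forces the end of the leg not to be adjacent to the centre,
    which compensates it.  With four legs, excess 2 is possible only on the
    longest leg, and it is harmless unless the centre is adjacent to all four
    ends, when the ends and the first vertex of the longest leg form a K_{1,5}
    with the centre. *)

(** * Weights along a leg *)

Lemma sum_nat_of_bool (T : Type) (p : pred T) (s : seq T) :
  \sum_(v <- s) (p v : nat) = count p s.
Proof. by elim: s => [|x s IH]; rewrite ?big_nil // big_cons IH. Qed.

Section LegCount.
Variables (T : eqType) (s : seq T) (I W : pred T) (o : T -> nat).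
Hypothesis Istep : forall a u v b, s = a ++ u :: v :: b ->
  I u -> o v = 0 /\ ~~ W v.
Hypothesis ostep : forall a u v b, s = a ++ u :: v :: b ->
  0 < o u -> 0 < o v -> o u <= 1 /\ o v <= 1.
Hypothesis Wstep : forall a u v b, s = a ++ u :: v :: b ->
  W u -> o v = 0 /\ ~~ W v.
Hypothesis Wo : forall a u b, s = a ++ u :: b -> W u -> o u = 0.
Hypothesis o_le2 : forall a u b, s = a ++ u :: b -> o u <= 2.
Hypothesis after_oI : forall a u b, s = a ++ u :: b ->
  o u = 2 -> I u -> {in b, forall z, o z = 0}.
Hypothesis after_oWI : forall a u v b, s = a ++ u :: v :: b ->
  o u = 2 -> W v -> I v -> {in b, forall z, o z = 0}.
Hypothesis after_WI : forall v b, s = v :: b ->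
  W v -> I v -> {in b, forall z, o z = 0}.
Hypothesis o_head : forall v b, s = v :: b -> o v = 0.
Hypothesis last0 : forall a x, s = rcons a x ->
  [/\ ~~ I x, ~~ W x & o x = 0].

(** In the applications [I] marks the neighbours of the end of the leg itself, [W] those of an
    outside vertex, and [o] counts the other leg ends adjacent to a vertex. When the sum equals the
    length, the second part keeps a witness of the run of excess 2. *)
Lemma leg_count : s <> [::] ->
  (\sum_(v <- s) (I v + W v + o v)) < size s \/
  (\sum_(v <- s) (I v + W v + o v)) = size s /\
    (has (fun u => o u == 2) s \/ exists v b, [/\ s = v :: b, W v & I v]).
Proof.
pose bad := has (fun u => o u == 2) s \/ exists v b, [/\ s = v :: b, W v & I v].
(* Runs of vertices adjacent to an end have excess at most 1 (stored in [e])
   over their length, and are separated by vertices of weight 0; [B] marks the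
   only run with excess 2. *)
have pre a u b : s = a ++ u :: b -> exists B : bool,
    \sum_(v <- rcons a u) (I v + W v + o v) <=
      size a + [|| I u, W u | 1 < o u] + B
    /\ (B -> [/\ bad, I u || (o u == 0) & {in b, forall z, o z = 0}]).
  elim/last_ind: a u b => [|a p IH] u b def_s.
    rewrite big_cons big_nil /= add0n.
    have ou := o_head def_s; rewrite ou.
    exists (W u && I u); split; first by case: (I u); case: (W u).
    move=> /andP[Wu Iu]; split; [|by rewrite Iu|exact: after_WI def_s Wu Iu].
    by right; exists u, b.
  have def_s' : s = a ++ p :: u :: b by rewrite def_s cat_rcons.
  have [B [leB badB]] := IH _ _ def_s'.
  have H1 := Istep def_s'; have H2 := ostep def_s'; have H3 := Wstep def_s'.
  have H4 := Wo def_s; have H5 := o_le2 def_s; have H5' := o_le2 def_s'.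
  have H6 := after_oI def_s; have H7 := after_oWI def_s'.
  have bad2 x : o x = 2 -> x \in s -> bad.
    by move=> /eqP x2 xs; left; apply/hasP; exists x.
  have us : u \in s by rewrite def_s mem_cat mem_head orbT.
  have ps : p \in s by rewrite def_s' mem_cat inE eqxx orbT.
  rewrite -cats1 big_cat big_seq1 /= size_rcons.
  (* Once the run of excess 2 has begun, [o] vanishes on the remaining vertices, and no further
     excess can build up. *)
  move: leB; case: B badB => [/(_ isT)[badT Ip o0] leB|_].
    have ou : o u = 0 by apply: o0; rewrite mem_head.
    exists true; split.
      move: Ip leB H1 H3 H4; rewrite ou.
      case: (I p); case: (W p); case: (I u); case: (W u) => /=; lia.
    move=> _; split; rewrite ?ou ?orbT // => z zb.
    by apply: o0; rewrite inE zb orbT.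
  (* First way to reach excess 2 beyond the head of the leg: a vertex with [o] equal to 2 also
     satisfies [I]. *)
  case: (boolP ((o u == 2) && I u)) => [/andP[/eqP ou Iu] leB|ouI].
    exists true; split; last by split; [exact: bad2 us|rewrite Iu|exact: H6].
    move: leB H1 H2 H3 H4; rewrite ou Iu.
    case: (I p); case: (W p); case: (W u) => /=; lia.
  (* Second way: a vertex with [o] equal to 2 is followed by one satisfying both [W] and [I]. *)
  case: (boolP [&& o p == 2, W u & I u]) => [/and3P[/eqP op Wu Iu] leB|opWI].
    exists true; split; last by split; [exact: bad2 ps|rewrite Iu|exact: H7].
    move: leB H1 H2 H3 H4; rewrite op Wu Iu.
    case: (I p); case: (W p) => /=; lia.
  move=> leB; exists false; split=> //.
  move: leB ouI opWI H1 H2 H3 H4.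
  case: (I p); case: (W p); case: (W u); case: (I u) => /=; lia.
case/lastP def_s: {1}s => [|a x] // _.
have def_s' : s = a ++ x :: [::] by rewrite cats1.
have [B [leB badB]] := pre _ _ _ def_s'.
have [Ix Wx ox] := last0 def_s.
(* The last vertex has weight 0, so the sum is at most [size s - 1 + B]. *)
move: leB; rewrite -def_s (negPf Ix) (negPf Wx) ox def_s size_rcons -def_s /=.
case: B badB => [/(_ isT)[badT _ _]|_] leB; last by left; lia.
case: ltngtP leB => //; [by left|lia|by move=> <-; right].
Qed.
End LegCount.

(** * Spiders *)

Section Spiders.
Variables (V : finType) (G : sgraph V).
Implicit Types (c u v w x y z : V) (s t a b : seq V).

(* Legs may be empty, so this covers spiders with fewer than four legs. *)
Definition spider c s1 s2 s3 s4 : bool :=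
  [&& path G c s1, path G c s2, path G c s3, path G c s4 &
      uniq (c :: s1 ++ s2 ++ s3 ++ s4)].

Definition spider_size s1 s2 s3 s4 : nat :=
  (size s1 + size s2 + size s3 + size s4).+1.

Lemma adjC u v : G u v = G v u. Proof. exact: adj_sym. Qed.

Lemma path_rev v b u : path G v b -> G u (last v b) ->
  path G u (rcons (rev b) v).
Proof.
elim: b v u => [|x b IH] v u /=; first by move=> _ ->.
move=> /andP[vx pb] ul; rewrite rev_cons rcons_path IH //= last_rcons.
by rewrite adjC.
Qed.

Lemma path_rev_leg c s u : path G c s -> G u (last c s) -> path G u (rev s).
Proof. by case: s => [|y s] //= /andP[_ ps] us; rewrite rev_cons path_rev. Qed.

Lemma path_turn c a u t : path G c a -> G u (last c a) -> path G c t ->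
  path G u (rev a ++ c :: t).
Proof.
by move=> pa ua pt; rewrite -cat_rcons cat_path path_rev // last_rcons.
Qed.

End Spiders.

(* The atoms are generalized because [lia] would case split on every boolean. *)
Ltac perm_solve :=
  apply/permP => ?; rewrite ?rev_cons -?cats1; repeat rewrite ?count_cat ?count_rev /=;
  repeat match goal with |- context [nat_of_bool ?b] =>
    generalize (nat_of_bool b) => ? end;
  lia.

Ltac path_split :=
  repeat match goal with
  | H : is_true (path _ _ (_ ++ _)) |- _ => move: H; rewrite cat_path => /andP[? ?]
  | H : is_true (path _ _ (_ :: _)) |- _ => move: H => /= /andP[? ?]
  | H : is_true (_ && _) |- _ => move: H => /andP[? ?]
  end.

Ltac path_solve := path_split;
  repeat first
  [ done
  | apply: path_turn
  | rewrite cat_path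
  | progress rewrite /= ?rev_cons ?last_cat ?last_rcons ?last_cons
  | apply/andP; split
  | apply: path_rev
  | apply: path_rev_leg
  | by rewrite adjC
  | eassumption ].

(** * Exchange moves and enlargements of spiders *)

Section Moves.
Variables (V : finType) (G : sgraph V).
Implicit Types (c u v w x y z : V) (s t a b : seq V).
Notation spider := (spider G).

Lemma spider_perm c s1 s2 s3 s4 c' t1 t2 t3 t4 :
  perm_eq (c' :: t1 ++ t2 ++ t3 ++ t4) (c :: s1 ++ s2 ++ s3 ++ s4) ->
  path G c' t1 -> path G c' t2 -> path G c' t3 -> path G c' t4 ->
  spider c s1 s2 s3 s4 -> spider c' t1 t2 t3 t4.
Proof.
by move=> /perm_uniq e p1 p2 p3 p4 /and5P[_ _ _ _]; rewrite -e => *; apply/and5P.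
Qed.

Lemma spider_add w c s1 s2 s3 s4 c' t1 t2 t3 t4 :
  w \notin c :: s1 ++ s2 ++ s3 ++ s4 ->
  perm_eq (c' :: t1 ++ t2 ++ t3 ++ t4) (w :: c :: s1 ++ s2 ++ s3 ++ s4) ->
  path G c' t1 -> path G c' t2 -> path G c' t3 -> path G c' t4 ->
  spider c s1 s2 s3 s4 -> spider c' t1 t2 t3 t4.
Proof.
move=> wS /perm_uniq e p1 p2 p3 p4 /and5P[_ _ _ _ US]; apply/and5P; split=> //.
by rewrite e cons_uniq wS.
Qed.

(** Like most of the exchange moves, this one keeps the vertex set and the centre and frees a
    leg. *)
Lemma move_ends c si sj sk sm : spider c si sj sk sm ->
  G (last c si) (last c sj) ->
  spider c (si ++ rev sj) sk sm [::].
Proof.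
move=> S e0; case/and5P: (S) => p1 p2 p3 p4 _.
by apply: spider_perm S; [perm_solve|path_solve..].
Qed.

Lemma move_head c y si sj sk sm : spider c (y :: si) sj sk sm ->
  G (last c sj) y ->
  spider c (sj ++ y :: si) sk sm [::].
Proof.
move=> S e0; case/and5P: (S) => p1 p2 p3 p4 _.
by apply: spider_perm S; [perm_solve|path_solve..].
Qed.

(** A Pósa rotation at [u] makes [v] the end of the leg, where [sj] is then appended backwards. *)
Lemma move_rotate c a u v b sj sk sm : spider c (a ++ u :: v :: b) sj sk sm ->
  G (last v b) u -> G (last c sj) v ->
  spider c (a ++ u :: rev (v :: b) ++ rev sj) sk sm [::].
Proof.
move=> S e0 e1; case/and5P: (S) => p1 p2 p3 p4 _.
by apply: spider_perm S; [perm_solve|path_solve..].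
Qed.

(** The edge from [u] to [v] is cut; the inner part continues into [sj] backwards, and the outer
    part continues [sk]. *)
Lemma move_cross c a u v b sj sk sm : spider c (a ++ u :: v :: b) sj sk sm ->
  G (last c sj) u -> G (last c sk) v ->
  spider c (a ++ u :: rev sj) (sk ++ v :: b) sm [::].
Proof.
move=> S e0 e1; case/and5P: (S) => p1 p2 p3 p4 _.
by apply: spider_perm S; [perm_solve|path_solve..].
Qed.

(** The leg bypasses [u], which becomes the link between the ends of [sj] and [sk]. *)
Lemma move_insert c a p u v b sj sk sm : spider c (a ++ p :: u :: v :: b) sj sk sm ->
  G p v -> G (last c sj) u -> G (last c sk) u ->
  spider c (a ++ p :: v :: b) (sj ++ u :: rev sk) sm [::].
Proof.
move=> S e0 e1 e2; case/and5P: (S) => p1 p2 p3 p4 _.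
by apply: spider_perm S; [perm_solve|path_solve..].
Qed.

(** The path hypothesis lets the end of the leg be followed by [d], so the cycle on [d ++ z :: e]
    can be entered at [z]. *)
Lemma move_cycle c a u d z e sj sk sm : spider c (a ++ u :: d ++ z :: e) sj sk sm ->
  path G (last z e) d -> G (last c sj) u -> G (last c sk) z ->
  spider c (a ++ u :: rev sj) (sk ++ z :: e ++ d) sm [::].
Proof.
move=> S e0 e1 e2; case/and5P: (S) => p1 p2 p3 p4 _.
by apply: spider_perm S; [perm_solve|path_solve..].
Qed.

Lemma move_cycle_leg c d z e sj sk sm : spider c (d ++ z :: e) sj sk sm ->
  path G (last z e) d -> G (last c sj) z ->
  spider c (sj ++ z :: e ++ d) sk sm [::].
Proof.
move=> S e0 e1; case/and5P: (S) => p1 p2 p3 p4 _.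
by apply: spider_perm S; [perm_solve|path_solve..].
Qed.

(** The old centre ends up inside the leg [rev a ++ c :: sm], which is longer than [sm]. *)
Lemma move_center c a u b sj sk sm : spider c (a ++ u :: b) sj sk sm ->
  G (last c sj) u -> G (last c sk) u ->
  spider u (rev a ++ c :: sm) b (rev sj) (rev sk).
Proof.
move=> S e0 e1; case/and5P: (S) => p1 p2 p3 p4 _.
by apply: spider_perm S; [perm_solve|path_solve..].
Qed.

Lemma move_lengthen c a u b sj sk sm : spider c (a ++ u :: b) sj sk sm ->
  G (last c sj) u ->
  spider c (sj ++ u :: b) a sk sm.
Proof.
move=> S e0; case/and5P: (S) => p1 p2 p3 p4 _.
by apply: spider_perm S; [perm_solve|path_solve..].
Qed.

Lemma extend_center c w s1 s2 s3 : spider c s1 s2 s3 [::] ->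
  w \notin c :: s1 ++ s2 ++ s3 ++ [::] ->
  G w c ->
  spider c s1 s2 s3 [:: w].
Proof.
move=> S wS e0; case/and5P: (S) => p1 p2 p3 p4 _.
by apply: (spider_add wS) S; [perm_solve|path_solve..].
Qed.

Lemma extend_end c w s1 s2 s3 s4 : spider c s1 s2 s3 s4 ->
  w \notin c :: s1 ++ s2 ++ s3 ++ s4 ->
  G w (last c s1) ->
  spider c (s1 ++ [:: w]) s2 s3 s4.
Proof.
move=> S wS e0; case/and5P: (S) => p1 p2 p3 p4 _.
by apply: (spider_add wS) S; [perm_solve|path_solve..].
Qed.

Lemma extend_rotate c w a u v b sj sk sm : spider c (a ++ u :: v :: b) sj sk sm ->
  w \notin c :: (a ++ u :: v :: b) ++ sj ++ sk ++ sm ->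
  G (last v b) u -> G w v ->
  spider c (a ++ u :: rev (v :: b) ++ [:: w]) sj sk sm.
Proof.
move=> S wS e0 e1; case/and5P: (S) => p1 p2 p3 p4 _.
by apply: (spider_add wS) S; [perm_solve|path_solve..].
Qed.

Lemma extend_insert c w a u v b sj sk sm : spider c (a ++ u :: v :: b) sj sk sm ->
  w \notin c :: (a ++ u :: v :: b) ++ sj ++ sk ++ sm ->
  G w u -> G w v ->
  spider c (a ++ u :: w :: v :: b) sj sk sm.
Proof.
move=> S wS e0 e1; case/and5P: (S) => p1 p2 p3 p4 _.
by apply: (spider_add wS) S; [perm_solve|path_solve..].
Qed.

Lemma extend_cross c w a u v b sj sk sm : spider c (a ++ u :: v :: b) sj sk sm ->
  w \notin c :: (a ++ u :: v :: b) ++ sj ++ sk ++ sm ->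
  G w u -> G (last c sj) v ->
  spider c (a ++ [:: u; w]) (sj ++ v :: b) sk sm.
Proof.
move=> S wS e0 e1; case/and5P: (S) => p1 p2 p3 p4 _.
by apply: (spider_add wS) S; [perm_solve|path_solve..].
Qed.

Lemma extend_branch c w a u b sj sk : spider c (a ++ u :: b) sj sk [::] ->
  w \notin c :: (a ++ u :: b) ++ sj ++ sk ++ [::] ->
  G w u -> G (last c sj) u ->
  spider u (rev a ++ c :: sk) b (rev sj) [:: w].
Proof.
move=> S wS e0 e1; case/and5P: (S) => p1 p2 p3 p4 _.
by apply: (spider_add wS) S; [perm_solve|path_solve..].
Qed.

(** The part after [u] is reattached to [c] at its far end, so that [u] becomes an end which [w] can
    extend. *)
Lemma extend_split c w a u b sj sk : spider c (a ++ u :: b) sj sk [::] ->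
  w \notin c :: (a ++ u :: b) ++ sj ++ sk ++ [::] ->
  G c (last u b) -> G w u ->
  spider c (a ++ [:: u; w]) (rev b) sj sk.
Proof.
move=> S wS e0 e1; case/and5P: (S) => p1 p2 p3 p4 _.
by apply: (spider_add wS) S; [perm_solve|path_solve..].
Qed.

(** Both cut legs leave inner parts [a] and [d] at [c], and [b] hangs from [c] by its far end. The
    rest forms one leg through [sk] and [u], then backwards from the end of [sj] to [z] and on to
    [w]. *)
Lemma extend_split_other c w a u b d z e sk : spider c (a ++ u :: b) (d ++ z :: e) sk [::] ->
  w \notin c :: (a ++ u :: b) ++ (d ++ z :: e) ++ sk ++ [::] ->
  G c (last u b) -> G (last z e) u -> G (last c sk) u -> G w z ->
  spider c a (rev b) (sk ++ u :: rev (z :: e) ++ [:: w]) d.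
Proof.
move=> S wS e0 e1 e2 e3; case/and5P: (S) => p1 p2 p3 p4 _.
by apply: (spider_add wS) S; [perm_solve|path_solve..].
Qed.

Lemma extend_path c w a z b t : spider c (a ++ z :: b) t [::] [::] ->
  w \notin c :: (a ++ z :: b) ++ t ++ [::] ++ [::] ->
  G w z ->
  spider z (rev a ++ c :: t) b [:: w] [::].
Proof.
move=> S wS e0; case/and5P: (S) => p1 p2 p3 p4 _.
by apply: (spider_add wS) S; [perm_solve|path_solve..].
Qed.

End Moves.

(** * Trees given by parent functions *)

Section ParentTree.
Variables (V : finType) (c : V) (par : V -> V) (depth : V -> nat).
Hypothesis par_depth : forall x, x != c -> depth (par x) < depth x.

Definition parent_rel : rel V :=
  fun x y => (x != c) && (par x == y) || (y != c) && (par y == x).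

Lemma parent_rel_sym : symmetric parent_rel.
Proof. by move=> x y; rewrite /parent_rel orbC. Qed.

Lemma parent_rel_irrefl : irreflexive parent_rel.
Proof.
move=> x; rewrite /parent_rel orbb; apply/negP => /andP[/par_depth lt /eqP e].
by rewrite e ltnn in lt.
Qed.

Definition parent_graph : sgraph V := SGraph parent_rel_sym parent_rel_irrefl.

Lemma parent_rel_deepest x y : parent_rel x y -> depth y <= depth x -> par x = y.
Proof.
case/orP => /andP[yc /eqP e] // le; have := par_depth yc; rewrite e; lia.
Qed.

(** Following parents decreases the depth and so leads to [c]. On a cycle, both neighbours of a
    deepest vertex would be its parent, although they are distinct. *)
Lemma parent_graph_tree : is_tree parent_graph.
Proof.
split; first split; first by apply/card_gt0P; exists c.
  have csym := sym_connect_sym parent_rel_sym.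
  suff root x : connect parent_rel c x.
    by move=> x y; apply: connect_trans (root y); rewrite csym.
  have [n] := ubnP (depth x); elim: n x => // n IH x le.
  have [->|xc] := eqVneq x c; first exact: connect0.
  apply: (@connect_trans _ _ (par x)); last first.
    by apply: connect1; rewrite /parent_rel xc eqxx orbT.
  by apply: IH; have := par_depth xc; lia.
move=> p sz_p /andP[cyc Up].
have [x0 x0p] : exists x, x \in p by case: (p) sz_p => // x *; exists x; rewrite mem_head.
case: (@arg_maxnP _ x0 (mem p) depth x0p) => x xp maxx.
have [i q def] := rot_to xp.
have {}cyc : path parent_rel x (rcons q x).
  by move: cyc; rewrite -(rot_cycle i) def.
have {}Up : uniq (x :: q) by rewrite -def rot_uniq.
have sz_q : 1 < size q by move: sz_p; rewrite -(size_rot i) def.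
have {}maxx y : y \in q -> depth y <= depth x.
  move=> yq; have yp : y \in p by rewrite -(mem_rot i) def inE yq orbT.
  exact: maxx yp.
case: q sz_q cyc Up maxx {def} => // y q sz_q /= /andP[xy].
rewrite rcons_path => /andP[_ zx] /and3P[_ yq _] maxx.
have py := parent_rel_deepest xy (maxx _ (mem_head _ _)).
rewrite parent_rel_sym in zx.
have pz := parent_rel_deepest zx (maxx _ (mem_last _ _)).
have yl : y = last y q by rewrite -pz.
move/negP: yq; apply; rewrite {1}yl.
by case: (q) sz_q => //= z r _; rewrite mem_last.
Qed.

End ParentTree.

(** * The tree of a spanning spider *)

Section SpiderTree.
Variables (V : finType) (G : sgraph V) (c : V) (s1 s2 s3 s4 : seq V).
Hypothesis S : spider G c s1 s2 s3 s4.
Hypothesis spanning : spider_size s1 s2 s3 s4 = #|V|.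
Implicit Types (u v x y z : V) (s t a b : seq V).

Let legs := [:: s1; s2; s3; s4].

Definition leg_of v : seq V :=
  if v \in s1 then s1 else if v \in s2 then s2 else if v \in s3 then s3 else s4.

(** Prefixing [c] shifts positions by one, so the index of [v] in its leg now points at its
    predecessor. *)
Definition parent v : V := nth c (c :: leg_of v) (index v (leg_of v)).

Definition depth v : nat := if v == c then 0 else (index v (leg_of v)).+1.

Lemma spider_spans v : v \in c :: s1 ++ s2 ++ s3 ++ s4.
Proof.
have U : uniq (c :: s1 ++ s2 ++ s3 ++ s4) by case/and5P: S.
have e : #|c :: s1 ++ s2 ++ s3 ++ s4| = #|V|.
  by rewrite (card_uniqP U) -spanning /= !size_cat !addnA.
by have /subset_cardP/(_ (subset_predT _)) -> := e.
Qed.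

Lemma leg_of_mem v : v != c -> v \in leg_of v.
Proof.
move=> vc; have := spider_spans v; rewrite inE (negPf vc) !mem_cat /leg_of /=.
by case: (boolP (v \in s1)); case: (boolP (v \in s2)); case: (boolP (v \in s3)).
Qed.

Lemma leg_of_legs v : leg_of v \in legs.
Proof. by rewrite /leg_of !inE; do 3?case: ifP => _; rewrite eqxx ?orbT. Qed.

Lemma leg_of_eq s v : s \in legs -> v \in s -> leg_of v = s.
Proof.
case/and5P: S => _ _ _ _ /= /andP[_]; rewrite !cat_uniq !has_cat !negb_or.
move=> /and3P[_ /and3P[d12 d13 d14] /and3P[_ /andP[d23 d24] /and3P[_ d34 _]]].
have out t t' : ~~ has (in_mem^~ (mem t)) t' -> v \in t' -> v \notin t.
  by move=> /hasPn d /d.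
rewrite !inE => /or4P[] /eqP-> vs; rewrite /leg_of.
- by rewrite vs.
- by rewrite (negPf (out _ _ d12 vs)) vs.
- by rewrite (negPf (out _ _ d13 vs)) (negPf (out _ _ d23 vs)) vs.
by rewrite (negPf (out _ _ d14 vs)) (negPf (out _ _ d24 vs)) (negPf (out _ _ d34 vs)).
Qed.

Lemma leg_path s : s \in legs -> path G c s /\ uniq (c :: s).
Proof.
case/and5P: S => p1 p2 p3 p4 /=; rewrite !mem_cat !negb_or !cat_uniq.
move=> /andP[/and4P[c1 c2 c3 c4] /and3P[u1 _ /and3P[u2 _ /and3P[u3 _ u4]]]].
by rewrite !inE => /or4P[] /eqP->; rewrite ?c1 ?c2 ?c3 ?c4.
Qed.

Lemma parent_adj v : v != c -> G (parent v) v.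
Proof.
move=> vc; have vs := leg_of_mem vc; have [/(pathP c) ps _] := leg_path (leg_of_legs v).
by have := ps (index v (leg_of v)); rewrite index_mem nth_index // => ->.
Qed.

Lemma parent_nth s i : s \in legs -> i < size s ->
  parent (nth c s i) = nth c (c :: s) i.
Proof.
move=> sl lt; have [_ /andP[_ Us]] := leg_path sl.
by rewrite /parent (leg_of_eq sl (mem_nth c lt)) index_uniq.
Qed.

Lemma depth_nth s i : s \in legs -> i < size s -> depth (nth c s i) = i.+1.
Proof.
move=> sl lt; have [_ /andP[cs Us]] := leg_path sl.
rewrite /depth (leg_of_eq sl (mem_nth c lt)) index_uniq //.
by case: eqP => // e; rewrite -e mem_nth in cs.
Qed.

Lemma leg_nth v : v != c -> exists s i, [/\ s \in legs, i < size s & v = nth c s i].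
Proof.
move=> vc; have vs := leg_of_mem vc; exists (leg_of v), (index v (leg_of v)).
by rewrite index_mem nth_index // leg_of_legs.
Qed.

Lemma parent_depth v : v != c -> depth (parent v) < depth v.
Proof.
move=> /leg_nth[s [i [sl lt ->]]]; rewrite (parent_nth sl lt) (depth_nth sl lt).
case: i lt => [|i] lt /=; first by rewrite /depth eqxx.
by rewrite (depth_nth sl (ltnW lt)).
Qed.

Let T := parent_graph parent_depth.

Lemma spider_tree_sub : subrel T G.
Proof.
move=> x y /orP[] /andP[nc /eqP <-]; last exact: parent_adj.
by rewrite adjC parent_adj.
Qed.

Lemma spider_tree_inner v : v != c -> degree T v <= 2.
Proof.
move=> vc; have [s [i [sl lt def]]] := leg_nth vc.
apply: leq_trans (card_size [:: parent v; nth c s i.+1]).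
apply/subset_leq_card/subsetP => x; rewrite !inE => /orP[/andP[_ /eqP->]|].
  by rewrite eqxx.
move=> /andP[/leg_nth[s' [j [sl' lt' ->]]]]; rewrite parent_nth //.
case: j lt' => [|j] lt' /= /eqP e; first by rewrite -e eqxx in vc.
have ss : s = s'.
  rewrite -(leg_of_eq sl (v := v)) ?def ?mem_nth // -def -e.
  by rewrite (leg_of_eq sl') // mem_nth // ltnW.
rewrite -ss in lt' e *; have [_ /andP[_ Us]] := leg_path sl.
move/eqP: e; rewrite def nth_uniq // 1?ltnW // => /eqP->.
by rewrite eqxx orbT.
Qed.

(** A leg vertex that is not last has a parent and a child, and these differ because their depths
    do. *)
Lemma spider_tree_leaf v : degree T v = 1 -> v \in c :: map (last c) legs.
Proof.
move=> dv; apply/negPn/negP; rewrite inE negb_or => /andP[vc vl].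
have [s [i [sl lt def]]] := leg_nth vc.
have lt1 : i.+1 < size s.
  rewrite ltn_neqAle lt andbT; apply: contra vl => /eqP e.
  apply/mapP; exists s => //; rewrite def -nth_last -e /=.
  exact: set_nth_default.
have nc : nth c s i.+1 != c.
  have [_ /andP[cs _]] := leg_path sl.
  by apply: contra cs => /eqP <-; exact: mem_nth.
have py : parent (nth c s i.+1) = v by rewrite parent_nth.
suff : 1 < degree T v by rewrite dv.
apply/card_gt1P; exists (parent v), (nth c s i.+1); split.
- by rewrite inE /= /parent_rel vc eqxx.
- by rewrite inE /= /parent_rel nc py eqxx orbT.
apply/eqP => e; have := parent_depth vc; have := parent_depth nc.
by rewrite py -e; lia.
Qed.

(** Only [c] can be a branch vertex. If [c] is a leaf, there is no branch vertex and at most five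
    leaves; otherwise the leaves are among the four leg ends. *)
Lemma spider_spanning_tree : exists T : sgraph V,
  spanning_tree G T /\ #|leaves T| + #|branch_vertices T| <= 5.
Proof.
exists T; split; first by split; [exact: spider_tree_sub|exact: parent_graph_tree].
have sub_branch : branch_vertices T \subset [set c].
  apply/subsetP => v; rewrite !inE; apply: contraLR => /spider_tree_inner.
  by rewrite -leqNgt.
have [c1|c1] := eqVneq (degree T c) 1.
  have -> : branch_vertices T = set0.
    apply/setP => v; rewrite inE [RHS]inE; apply/negP => bv.
    have : v \in branch_vertices T by rewrite inE.
    by move=> /(subsetP sub_branch)/set1P vc; rewrite vc c1 in bv.
  rewrite cards0 addn0; apply: leq_trans (card_size (c :: map (last c) legs)).
  by apply/subset_leq_card/subsetP => v; rewrite inE => /eqP/spider_tree_leaf.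
rewrite -[5]/(4 + 1); apply: leq_add; last first.
  by rewrite -(cards1 c); exact: subset_leq_card.
apply: leq_trans (card_size (map (last c) legs)).
apply/subset_leq_card/subsetP => v; rewrite inE => /eqP dv.
have := spider_tree_leaf dv; rewrite inE => /predU1P[vc|//].
by rewrite -vc dv eqxx in c1.
Qed.

End SpiderTree.

(** * Maximum spiders with four nonempty legs *)

Section Degrees.
Variables (V : finType) (G : sgraph V).
Implicit Types (u v w x y z : V) (p : seq V).

Definition nonadj u v : bool := ~~ G u v.

Lemma all2rel_nonadj p : pairwise nonadj p -> all2rel nonadj p.
Proof.
rewrite pairwise_all2rel //; first by move=> x; rewrite /nonadj adj_irrefl.
by move=> x y; rewrite /nonadj adjC.
Qed.

(** Stated as a repetition in the list, so that each application reduces to showing five vertices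
    distinct. *)
Lemma no_claw u p : star_free 5 G -> size p = 5 ->
  all (G u) p -> pairwise nonadj p -> ~~ uniq p.
Proof.
move=> free sz_p /allP up /all2rel_nonadj/allrelP ind; apply/negP => Up.
have mem (i : 'I_5) : nth u p i \in p by rewrite mem_nth ?sz_p.
apply: free; exists (oapp (fun i : 'I_5 => nth u p i) u).
  case=> [i|] [j|] //= => [/eqP|eu|eu].
  - by rewrite nth_uniq ?sz_p // => /eqP/val_inj->.
  - by have := up _ (mem i); rewrite eu adj_irrefl.
  - by have := up _ (mem j); rewrite -eu adj_irrefl.
case=> [i|] [j|] /=; rewrite /star_rel /=.
- exact/negbTE/ind.
- by rewrite adjC up.
- by rewrite up.
- exact: adj_irrefl.
Qed.

Lemma degree_le_count x p : (forall v, G x v -> v \in p) ->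
  degree G x <= count (G x) p.
Proof.
move=> xp; rewrite -size_filter /degree; apply: leq_trans (card_size _).
by apply/subset_leq_card/subsetP => v; rewrite inE mem_filter => xv; rewrite xv xp.
Qed.

(** Strict because [w] itself lies outside [p] and is not its own neighbour. *)
Lemma degree_lt_count w p : uniq p -> w \notin p ->
  degree G w + size p < count (G w) p + #|V|.
Proof.
move=> Up wp; pose P := [set v in p].
have cP : #|P| = size p by rewrite cardsE; exact/card_uniqP.
have lt_in : #|[set v | G w v] :&: P| <= count (G w) p.
  rewrite -size_filter; apply: leq_trans (card_size _).
  apply/subset_leq_card/subsetP => v.
  by rewrite !inE mem_filter.
have lt_out : #|[set v | G w v] :\: P| < #|~: P|.
  apply/proper_card/properP; split; first by apply/subsetP => v; rewrite !inE => /andP[].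
  by exists w; rewrite !inE ?wp // adj_irrefl andbF.
have := cardsC P; have := cardsID P [set v | G w v]; rewrite /degree; lia.
Qed.

Lemma degree_sum_four x1 x2 x3 x4 : leq_inf (#|V| - 1) (sigma G 4) ->
  uniq [:: x1; x2; x3; x4] -> pairwise nonadj [:: x1; x2; x3; x4] ->
  #|V| - 1 <= degree G x1 + degree G x2 + degree G x3 + degree G x4.
Proof.
set p := [:: _; _; _; _] => /leq_inf_sigmaP deg Up /all2rel_nonadj/allrelP ind.
have := deg [set v in p]; rewrite /degree_sum.
have -> : \sum_(v in [set v in p]) degree G v = \sum_(v <- p) degree G v.
  rewrite big_uniq //; apply: eq_bigl => v; by rewrite inE.
rewrite !big_cons big_nil addn0 !addnA; apply.
apply/andP; split; last by rewrite cardsE; apply/eqP/card_uniqP.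
apply/forall_inP => x; rewrite inE => xp; apply/forall_inP => y; rewrite inE => yp.
exact: ind.
Qed.

End Degrees.

(** * Adjacencies excluded by exchange moves *)

Section Pairs.
Variables (V : finType) (G : sgraph V).
Implicit Types (c u v w x y z : V) (s t a b : seq V).
Notation spider := (spider G).

Lemma spider_swap12 c s1 s2 s3 s4 : spider c s1 s2 s3 s4 -> spider c s2 s1 s3 s4.
Proof.
by move=> S; case/and5P: (S) => *; apply: spider_perm S => //; perm_solve.
Qed.

Lemma spider_swap23 c s1 s2 s3 s4 : spider c s1 s2 s3 s4 -> spider c s1 s3 s2 s4.
Proof.
by move=> S; case/and5P: (S) => *; apply: spider_perm S => //; perm_solve.
Qed.

Lemma spider_swap34 c s1 s2 s3 s4 : spider c s1 s2 s3 s4 -> spider c s1 s2 s4 s3.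
Proof.
by move=> S; case/and5P: (S) => *; apply: spider_perm S => //; perm_solve.
Qed.

Lemma spider_uniq c s1 s2 s3 s4 : spider c s1 s2 s3 s4 ->
  uniq (c :: s1 ++ s2 ++ s3 ++ s4).
Proof. by case/and5P. Qed.

Lemma uniq_of_perm (s t : seq V) : perm_eq s t -> uniq s -> uniq t.
Proof. by move=> /perm_uniq ->. Qed.

(* Used for a maximum spider with an empty leg [sm], and for every leg [sm] of
   an irreducible spider. *)
Definition stuck sm n : Prop := forall c t1 t2,
  spider c t1 t2 sm [::] -> spider_size t1 t2 sm [::] <> n.

Section Pair.
Variables (c : V) (si sj sk sm : seq V).
Hypothesis S : spider c si sj sk sm.
Hypothesis st : stuck sm (spider_size si sj sk sm).

Lemma stuck_ends : ~~ G (last c si) (last c sj).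
Proof.
apply/negP => e; apply: (st (move_ends S e)).
by rewrite /spider_size size_cat size_rev /=; lia.
Qed.

Lemma stuck_head y b : si = y :: b -> ~~ G (last c sj) y.
Proof.
move=> def; apply/negP => e; move: S; rewrite def => S'.
apply: (st (move_head S' e)).
by rewrite def /spider_size /= !size_cat /=; lia.
Qed.

Lemma stuck_rotate a u v b : si = a ++ u :: v :: b ->
  G (last c si) u -> ~~ G (last c sj) v.
Proof.
move=> def iu; apply/negP => e; move: S iu; rewrite def last_cat /= => S' iu.
apply: (st (move_rotate S' iu e)).
by rewrite def /spider_size !size_cat /= size_cat !size_rev /=; lia.
Qed.

Lemma stuck_cross a u v b : si = a ++ u :: v :: b ->
  G (last c sj) u -> ~~ G (last c sk) v.
Proof.
move=> def ju; apply/negP => kv; move: S; rewrite def => S'.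
apply: (st (move_cross S' ju kv)).
by rewrite def /spider_size !size_cat /= size_rev /=; lia.
Qed.

Lemma stuck_insert a p u v b : si = a ++ p :: u :: v :: b ->
  G (last c sj) u -> G (last c sk) u -> ~~ G p v.
Proof.
move=> def ju ku; apply/negP => pv; move: S; rewrite def => S'.
apply: (st (move_insert S' pv ju ku)).
by rewrite def /spider_size !size_cat /= size_rev /=; lia.
Qed.

Lemma stuck_cycle a u d z e : si = a ++ u :: d ++ z :: e ->
  path G (last c si) d -> G (last c sj) u -> ~~ G (last c sk) z.
Proof.
move=> def pd ju; apply/negP => kz; move: S pd; rewrite def.
rewrite last_cat /= last_cat /= => S' pd.
apply: (st (move_cycle S' pd ju kz)).
by rewrite def /spider_size !size_cat /= !size_cat size_rev /=; lia.
Qed.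

Lemma stuck_cycle_leg d z e : si = d ++ z :: e ->
  path G (last c si) d -> ~~ G (last c sj) z.
Proof.
move=> def pd; apply/negP => jz; move: S pd; rewrite def last_cat /= => S' pd.
apply: (st (move_cycle_leg S' pd jz)).
by rewrite def /spider_size !size_cat /= !size_cat /=; lia.
Qed.

End Pair.

Section AlphaCycle.
Variables (c : V) (si sj sk sm : seq V).
Hypothesis S : spider c si sj sk sm.
Hypothesis st : stuck sm (spider_size si sj sk sm).
Hypothesis free : star_free 5 G.
Hypotheses (j0 : sj <> [::]) (k0 : sk <> [::]).

(* Otherwise [u] is the centre of a [K_{1,5}] whose leaves are its neighbours
   on the leg and the ends of the three legs. *)
Lemma alpha_cycle a p u d z e : si = a ++ p :: u :: d ++ z :: e ->
  G (last c si) u -> G (last c sj) u -> G (last c sk) u ->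
  path G (last c si) d.
Proof.
move=> def iu ju ku; case: d def => [|v d] //= def.
have pd : path G v d.
  by case/and5P: S; rewrite def !cat_path /= cat_path => /and5P[_ _ _ _ /andP[]].
rewrite pd andbT; apply/negPn/negP => niv.
have S' := spider_swap23 S.
have st' : stuck sm (spider_size si sk sj sm).
  by move: st; rewrite /spider_size (addnAC (size si)).
have S3 : spider c sj sk si sm by apply/spider_swap23/spider_swap12.
have st3 : stuck sm (spider_size sj sk si sm).
  by move: st; rewrite /spider_size [size si + _]addnC (addnAC (size sj)).
have ij := stuck_ends S st; have ik := stuck_ends S' st'.
have jk := stuck_ends S3 st3.
have def1 : si = a ++ p :: u :: (v :: d ++ z :: e) by rewrite def.
have ip : ~~ G (last c si) p.
  by apply/negP => /(stuck_rotate S st def1); rewrite ju.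
have jp : ~~ G (last c sj) p.
  by apply/negP => /(stuck_cross S st def1); rewrite ku.
have kp : ~~ G (last c sk) p.
  by apply/negP => /(stuck_cross S' st' def1); rewrite ju.
have def2 : si = rcons a p ++ u :: v :: (d ++ z :: e) by rewrite cat_rcons def.
have kv := stuck_cross S st def2 ju; have jv := stuck_cross S' st' def2 ku.
have pv := stuck_insert S st def ju ku.
have pu : G p u.
  by case/and5P: S; rewrite def cat_path /= => /and4P[_ _ ? _].
have uv : G u v.
  by case/and5P: S; rewrite def cat_path /= => /and5P[_ _ _ ? _].
suff: uniq [:: last c si; last c sj; last c sk; p; v].
  apply/negP/(no_claw (u := u) free) => //=; last first.
    by rewrite /nonadj ij ik ip niv jk jp jv kp kv pv.
  by rewrite uv !(adjC G u) iu ju ku pu.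
(* The five vertices occupy different places of the spider; the nonempty part [z :: e] separates the
   end of [si] from [v]. *)
move: (spider_uniq S).
have -> : last c si = last z e by rewrite def last_cat /= last_cat.
rewrite def.
case/lastP: sj j0 => // tj xj _; case/lastP: sk k0 => // tk xk _.
rewrite !last_rcons (lastI z e).
set x := last z e; set t := belast z e => U.
suff : uniq ([:: x; xj; xk; p; v] ++ u :: c :: a ++ d ++ t ++ tj ++ tk ++ sm).
  by rewrite cat_uniq => /andP[].
clearbody x t; clear -U.
by apply: uniq_of_perm U; perm_solve.
Qed.

End AlphaCycle.

(** Legs can be permuted, so this says that all four legs of every spider with [n] vertices are
    nonempty. *)
Definition irreducible n : Prop := forall c t1 t2 t3,
  spider c t1 t2 t3 [::] -> spider_size t1 t2 t3 [::] <> n.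

Section FourLegs.
Variables (c : V) (si sj sk sm : seq V).
Hypothesis S : spider c si sj sk sm.
Hypothesis irr : irreducible (spider_size si sj sk sm).
Hypothesis free : star_free 5 G.
Hypotheses (i0 : si <> [::]) (j0 : sj <> [::]) (k0 : sk <> [::]) (m0 : sm <> [::]).

Definition others u : nat :=
  G (last c sj) u + G (last c sk) u + G (last c sm) u.

(** Irreducibility allows any leg to be the spared one. The instances below give [sj], [sk] and [sm]
    in all six orders, so that the exchange arguments apply to every pair of other ends. *)
Let stk s c' t1 t2 t3 : spider c' t1 t2 t3 s ->
  spider_size t1 t2 t3 s = spider_size si sj sk sm ->
  stuck s (spider_size t1 t2 t3 s).
Proof. by move=> _ -> c1 u1 u2 Su; apply: irr Su. Qed.

Ltac size_perm := rewrite /spider_size; lia.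

Let Sjk := S.
Let Skj := spider_swap23 S.
Let Sjm := spider_swap34 S.
Let Smj := spider_swap23 Sjm.
Let Skm := spider_swap34 Skj.
Let Smk := spider_swap23 Skm.
Let stjk := stk Sjk ltac:(size_perm).
Let stkj := stk Skj ltac:(size_perm).
Let stjm := stk Sjm ltac:(size_perm).
Let stmj := stk Smj ltac:(size_perm).
Let stkm := stk Skm ltac:(size_perm).
Let stmk := stk Smk ltac:(size_perm).

Lemma others_ends : others (last c si) = 0.
Proof.
rewrite /others !(adjC G _ (last c si)).
rewrite (negPf (stuck_ends Sjk stjk)) (negPf (stuck_ends Skj stkj)).
by rewrite (negPf (stuck_ends Smj stmj)).
Qed.

Lemma others_head y b : si = y :: b -> others y = 0.
Proof.
move=> def; rewrite /others (negPf (stuck_head Sjk stjk def)).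
by rewrite (negPf (stuck_head Skj stkj def)) (negPf (stuck_head Smj stmj def)).
Qed.

Lemma others_rotate a u v b : si = a ++ u :: v :: b ->
  G (last c si) u -> others v = 0.
Proof.
move=> def iu; rewrite /others (negPf (stuck_rotate Sjk stjk def iu)).
by rewrite (negPf (stuck_rotate Skj stkj def iu)) (negPf (stuck_rotate Smj stmj def iu)).
Qed.

(** By [stuck_cross], consecutive vertices are not adjacent to different other ends, so both see one
    and the same end. *)
Lemma others_step a u v b : si = a ++ u :: v :: b ->
  0 < others u -> 0 < others v -> others u <= 1 /\ others v <= 1.
Proof.
move=> def; rewrite /others.
have := stuck_cross Sjk stjk def; have := stuck_cross Skj stkj def.
have := stuck_cross Sjm stjm def; have := stuck_cross Smj stmj def.
have := stuck_cross Skm stkm def; have := stuck_cross Smk stmk def.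
case: (G _ u); case: (G _ u); case: (G _ u);
by do 3?[case: (G _ v) => //=]; do ?[move=> /(_ isT) // | move=> _].
Qed.

(** Whichever end is adjacent to [z], one of the two ends adjacent to [u] differs from it, and
    [stuck_cycle] applies. *)
Lemma others_cycle a u d z e : si = a ++ u :: d ++ z :: e ->
  path G (last c si) d -> 1 < others u -> others z = 0.
Proof.
move=> def pd; rewrite /others.
have := stuck_cycle Sjk stjk def pd; have := stuck_cycle Skj stkj def pd.
have := stuck_cycle Sjm stjm def pd; have := stuck_cycle Smj stmj def pd.
have := stuck_cycle Skm stkm def pd; have := stuck_cycle Smk stmk def pd.
case: (G _ u); case: (G _ u); case: (G _ u);
by do 3?[case: (G _ z) => //=]; do ?[move=> /(_ isT) // | move=> _].
Qed.

Lemma others_cycle_leg d z e : si = d ++ z :: e ->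
  path G (last c si) d -> others z = 0.
Proof.
move=> def pd; rewrite /others (negPf (stuck_cycle_leg Sjk stjk def pd)).
by rewrite (negPf (stuck_cycle_leg Skj stkj def pd)) (negPf (stuck_cycle_leg Smj stmj def pd)).
Qed.

Lemma ends_nonadj : pairwise (nonadj G) [:: last c si; last c sj; last c sk; last c sm].
Proof.
have := others_ends; rewrite /others.
have S1 := spider_swap12 Sjk; have S2 := spider_swap23 S1.
have := stuck_ends S2 (stk S2 ltac:(size_perm)).
have S3 := spider_swap34 S1; have S4 := spider_swap23 S3.
have := stuck_ends S4 (stk S4 ltac:(size_perm)).
have S5 := spider_swap12 Skm; have S6 := spider_swap23 S5.
have := stuck_ends S6 (stk S6 ltac:(size_perm)).
rewrite /= /nonadj => -> -> ->; rewrite !(adjC G (last c si)).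
by do 3?[case: (G _ _)].
Qed.

(** With three ends adjacent to [u], [others_step] makes both leg neighbours of [u] nonadjacent to
    these ends, and [stuck_insert] makes them nonadjacent to each other. Together they form an
    induced [K_{1,5}] at [u]. *)
Lemma others_le2 a u b : si = a ++ u :: b -> others u <= 2.
Proof.
case/lastP: a => [|a p] def; first by rewrite (others_head def).
case: b def => [|v b] def.
  by have := others_ends; rewrite def last_cat /= => ->.
rewrite leqNgt; apply/negP => ou.
have [[ju ku] mu] : (G (last c sj) u /\ G (last c sk) u) /\ G (last c sm) u.
  by move: ou; rewrite /others; do 3!case: (G _ u).
have ou2 : 1 < others u by apply: ltn_trans ou.
have def1 : si = a ++ p :: u :: v :: b by rewrite def cat_rcons.
have op : others p = 0 by have := others_step def1; lia.
have ov : others v = 0 by have := others_step def; lia.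
have pv := stuck_insert Sjk stjk def1 ju ku.
have pu : G p u.
  by case/and5P: S; rewrite def1 cat_path /= => /and4P[_ _ ? _].
have uv : G u v.
  by case/and5P: S; rewrite def1 cat_path /= => /and5P[_ _ _ ? _].
have [[jp kp] mp] : (~~ G (last c sj) p /\ ~~ G (last c sk) p) /\ ~~ G (last c sm) p.
  by move: op; rewrite /others; do 3!case: (G _ p).
have [[jv kv] mv] : (~~ G (last c sj) v /\ ~~ G (last c sk) v) /\ ~~ G (last c sm) v.
  by move: ov; rewrite /others; do 3!case: (G _ v).
suff: uniq [:: last c sj; last c sk; last c sm; p; v].
  apply/negP/(no_claw (u := u) free) => //=; last first.
    have /= := ends_nonadj; rewrite /nonadj jp kp mp jv kv mv pv.
    by rewrite !andbT => /and3P[_ /andP[-> ->] ->].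
  by rewrite uv !(adjC G u) ju ku mu pu.
move: (spider_uniq S); rewrite def1.
case/lastP: sj j0 => // tj xj _; case/lastP: sk k0 => // tk xk _.
case/lastP: sm m0 => // tm xm _.
rewrite !last_rcons => U.
suff : uniq ([:: xj; xk; xm; p; v] ++ u :: c :: a ++ b ++ tj ++ tk ++ tm).
  by rewrite cat_uniq => /andP[].
by clear -U; apply: uniq_of_perm U; perm_solve.
Qed.

(** [alpha_cycle], applied to the two other ends adjacent to [u], provides the path that
    [others_cycle] requires. *)
Lemma others_alpha a u b : si = a ++ u :: b -> others u = 2 ->
  G (last c si) u -> {in b, forall z, others z = 0}.
Proof.
move=> def ou iu z zb; case/splitPr: zb def => d e def.
apply: (others_cycle def); last by rewrite ou.
case/lastP: a def => [|a p]; first by move=> /others_head; rewrite ou.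
rewrite cat_rcons => def; move: ou; rewrite /others.
case ju: (G (last c sj) u); case ku: (G (last c sk) u); case mu: (G (last c sm) u) => // _.
- exact: (alpha_cycle Sjk stjk free j0 k0 def).
- exact: (alpha_cycle Sjm stjm free j0 m0 def).
- exact: (alpha_cycle Skm stkm free k0 m0 def).
Qed.

(** All four chosen vertices are leg ends, so [leg_count] is used with [W] empty. *)
Lemma four_legs_count :
  \sum_(v <- si) (G (last c si) v + others v) < size si \/
  \sum_(v <- si) (G (last c si) v + others v) = size si /\
    has (fun u => others u == 2) si.
Proof.
have eqs : \sum_(v <- si) (G (last c si) v + others v) =
    \sum_(v <- si) (G (last c si) v + (xpred0 : pred V) v + others v).
  by apply: eq_bigr => v _; rewrite addn0.
rewrite eqs; case: (@leg_count _ si (G (last c si)) xpred0 others) => //.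
- by move=> a u v b def iu; rewrite (others_rotate def iu).
- exact: others_step.
- exact: others_le2.
- exact: others_alpha.
- exact: others_head.
- move=> a x def; have := others_ends; rewrite def last_rcons.
  by rewrite adj_irrefl.
- by left.
- by move=> [-> [ho|[v [b []]]]] //; right.
Qed.

End FourLegs.
End Pairs.

(** * The degree bound for four legs *)

Section FourLegsBound.
Variables (V : finType) (G : sgraph V).
Implicit Types (c u v w x y z : V) (s t a b : seq V).
Notation spider := (spider G).

(** The list [behead (belast c s1)] is [s1] without its last vertex. *)
Lemma uniq_ends c s1 s2 s3 s4 : spider c s1 s2 s3 s4 ->
  s1 <> [::] -> s2 <> [::] -> s3 <> [::] -> s4 <> [::] ->
  uniq ([:: last c s1; last c s2; last c s3; last c s4] ++ behead (belast c s1)).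
Proof.
move=> /spider_uniq U n1 n2 n3 n4; case/lastP: s1 n1 U => // t1 x1 _.
case/lastP: s2 n2 => // t2 x2 _; case/lastP: s3 n3 => // t3 x3 _.
case/lastP: s4 n4 => // t4 x4 _ U; rewrite !last_rcons belast_rcons.
suff : uniq (([:: x1; x2; x3; x4] ++ t1) ++ c :: t2 ++ t3 ++ t4).
  by rewrite cat_uniq => /andP[].
by apply: uniq_of_perm U; perm_solve.
Qed.

Lemma sum_others c si sj sk sm :
  \sum_(v <- si) (G (last c si) v + others G c sj sk sm v) =
  count (G (last c si)) si + count (G (last c sj)) si +
  count (G (last c sk)) si + count (G (last c sm)) si.
Proof. by rewrite /others !big_split /= !sum_nat_of_bool !addnA. Qed.

(** If the end of [s1] is adjacent to [u], it can take over the tail of [si] from [u] on. Otherwise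
    the two other ends are adjacent to [u], and making [u] the centre puts [s1] and [c] on one leg.
    Either way a leg longer than [s1] arises. *)
Lemma longest_others c s1 si sk sm : spider c si s1 sk sm ->
  (forall c' t1 t2 t3 t4, spider c' t1 t2 t3 t4 ->
     spider_size t1 t2 t3 t4 = spider_size si s1 sk sm -> size t1 <= size s1) ->
  ~~ has (fun u => others G c s1 sk sm u == 2) si.
Proof.
move=> S longest; apply/hasP => -[u ui /eqP ou].
case/splitPr: ui S longest ou => a b S longest ou.
case u1: (G (last c s1) u).
  have := longest _ _ _ _ _ (move_lengthen S u1).
  by rewrite /spider_size !size_cat /=; lia.
have [uk um] : G (last c sk) u /\ G (last c sm) u.
  by move: ou; rewrite /others u1; do 2!case: (G _ u).
have S' := spider_swap34 (spider_swap23 (spider_swap34 (spider_swap23 S))).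
have S'' := spider_swap23 (spider_swap34 (spider_swap23 S)).
have := longest _ _ _ _ _ (move_center (spider_swap23 S'') uk um).
by rewrite /spider_size !size_cat /= !size_rev; lia.
Qed.

Lemma four_legs_bound c s1 s2 s3 s4 : spider c s1 s2 s3 s4 ->
  irreducible G (spider_size s1 s2 s3 s4) -> star_free 5 G ->
  (forall c' t1 t2 t3 t4, spider c' t1 t2 t3 t4 ->
     spider_size t1 t2 t3 t4 = spider_size s1 s2 s3 s4 -> size t1 <= size s1) ->
  let p := c :: s1 ++ s2 ++ s3 ++ s4 in
  [/\ pairwise (nonadj G) [:: last c s1; last c s2; last c s3; last c s4],
      uniq [:: last c s1; last c s2; last c s3; last c s4] &
  count (G (last c s1)) p + count (G (last c s2)) p +
  count (G (last c s3)) p + count (G (last c s4)) p < size p].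
Proof.
move=> S irr free longest.
have sizes t1 t2 t3 t4 : spider c t1 t2 t3 t4 -> spider_size t1 t2 t3 t4 =
    spider_size s1 s2 s3 s4 -> [/\ t1 <> [::], t2 <> [::], t3 <> [::] & t4 <> [::]].
  move=> St e; split=> t0; move: St e; rewrite t0 => St e.
  - apply: (irr _ _ _ _ (spider_swap34 (spider_swap23 (spider_swap12 St)))).
    by rewrite -e /spider_size /=; lia.
  - apply: (irr _ _ _ _ (spider_swap34 (spider_swap23 St))).
    by rewrite -e /spider_size /=; lia.
  - by apply: (irr _ _ _ _ (spider_swap34 St)); rewrite -e /spider_size /=; lia.
  - by apply: (irr _ _ _ _ St); rewrite -e.
have [n1 n2 n3 n4] := sizes _ _ _ _ S erefl.
move=> p; split; first exact: ends_nonadj S irr.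
  by have := uniq_ends S n1 n2 n3 n4; rewrite cat_uniq => /andP[].
have S2 := spider_swap12 S; have S3 := spider_swap12 (spider_swap23 S).
have S4 := spider_swap12 (spider_swap23 (spider_swap34 S)).
have e2 : spider_size s2 s1 s3 s4 = spider_size s1 s2 s3 s4 by rewrite /spider_size; lia.
have e3 : spider_size s3 s1 s2 s4 = spider_size s1 s2 s3 s4 by rewrite /spider_size; lia.
have e4 : spider_size s4 s1 s2 s3 = spider_size s1 s2 s3 s4 by rewrite /spider_size; lia.
have := four_legs_count S irr free n1 n2 n3 n4.
have := four_legs_count S2; have := four_legs_count S3; have := four_legs_count S4.
rewrite e2 e3 e4 => /(_ irr free n4 n1 n2 n3) L4 /(_ irr free n3 n1 n2 n4) L3.
move=> /(_ irr free n2 n1 n3 n4) L2 L1.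
have := longest_others S2; have := longest_others S3; have := longest_others S4.
rewrite e2 e3 e4 => /(_ longest)/negPf h4 /(_ longest)/negPf h3 /(_ longest)/negPf h2.
case: L2; last by rewrite h2 => -[].
case: L3; last by rewrite h3 => -[].
case: L4; last by rewrite h4 => -[].
rewrite !sum_others => L4 L3 L2; rewrite sum_others in L1.
rewrite /p /= !count_cat !size_cat.
have leB (b : bool) : b <= 1 by case: b.
case: L1 => [L1|[L1 /hasP[u us /eqP ou]]].
  (* Each of the four legs falls short of its length, which pays for up to four ends adjacent to the
     centre. *)
  have b1 := leB (G (last c s1) c); have b2 := leB (G (last c s2) c).
  have b3 := leB (G (last c s3) c); have b4 := leB (G (last c s4) c).
  move: b1 b2 b3 b4 L1 L2 L3 L4; clear.
  do 4!move: (nat_of_bool _) => ?; lia.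
(* Now only three legs fall short, so the centre must miss one end. *)
suff : ~~ [&& G (last c s1) c, G (last c s2) c, G (last c s3) c & G (last c s4) c].
  move: L1 L2 L3 L4; clear.
  case: (G (last c s1) c); case: (G (last c s2) c); case: (G (last c s3) c);
    case: (G (last c s4) c) => //=; lia.
apply/negP => /and4P[c1 c2 c3 c4].
have [y [b def]] : exists y b, s1 = y :: b by case: (s1) n1 => // y b; exists y, b.
have oy := others_head S irr def.
have cy : G c y by case/and5P: S; rewrite def /= => /andP[].
(* If [y] were adjacent to the end of [s1], the part before [u] could follow that end, and
   [others_cycle_leg] would give [others] the value 0 at [u]. *)
have y1 : ~~ G (last c s1) y.
  apply/negP => iy.
  have [d [e de]] : exists d e, s1 = d ++ u :: e by case/splitPr: us => d e; exists d, e.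
  have pd : path G (last c s1) d.
    case: d de => [|v d] // de; move: (de); rewrite {1}def => -[ev _].
    rewrite -ev /=. rewrite iy /=.
    by case/and5P: S; rewrite de -ev /= cat_path => /and3P[].
  by have := others_cycle_leg S irr de pd; rewrite ou.
have [[y2 y3] y4] : (~~ G (last c s2) y /\ ~~ G (last c s3) y) /\ ~~ G (last c s4) y.
  by move: oy; rewrite /others; do 3!case: (G _ y).
suff: uniq [:: last c s1; last c s2; last c s3; last c s4; y].
  apply/negP/(no_claw (u := c) free) => //=; last first.
    have /= := ends_nonadj S irr; rewrite /nonadj y1 y2 y3 y4.
    by rewrite !andbT => /and3P[/and3P[-> -> ->] /andP[-> ->] ->].
  by rewrite cy !(adjC G c) c1 c2 c3 c4.
(* If [y] were the only vertex of [s1], it would be [u], although [others] is 0 at [y] and 2 at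
   [u]. *)
case/lastP: b def => [|b x1] def.
  by move: us ou; rewrite def inE => /eqP->; rewrite oy.
have := uniq_ends S n1 n2 n3 n4; set A := [:: last c s1; _; _; _].
rewrite -[[:: _; _; _; _; y]]/(A ++ [:: y]) !cat_uniq => /and3P[-> yA _] /=.
rewrite orbF andbT; apply: contra yA => yA; apply/hasP; exists y => //.
by rewrite def /= belast_rcons mem_head.
Qed.

End FourLegsBound.

(** * Maximum spiders with an empty leg *)

Section ThreeLegs.
Variables (V : finType) (G : sgraph V).
Implicit Types (c u v x y z : V) (s t a b : seq V).
Notation spider := (spider G).
Variables (c : V) (si sj sk : seq V) (w : V).
Hypothesis S : spider c si sj sk [::].
Hypothesis wS : w \notin c :: si ++ sj ++ sk ++ [::].
Hypothesis st : stuck G [::] (spider_size si sj sk [::]).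
Hypothesis maxS : forall c' t1 t2 t3 t4, spider c' t1 t2 t3 t4 ->
  spider_size t1 t2 t3 t4 <= spider_size si sj sk [::].
Hypothesis free : star_free 5 G.
Hypotheses (i0 : si <> [::]) (j0 : sj <> [::]) (k0 : sk <> [::]).

Definition others2 u : nat := G (last c sj) u + G (last c sk) u.

Let S' := spider_swap23 S.
Let st' : stuck G [::] (spider_size si sk sj [::]).
Proof. by move: st; rewrite /spider_size (addnAC (size si)). Qed.
Let wS' : w \notin c :: si ++ sk ++ sj ++ [::].
Proof. by move: wS; rewrite !(inE, mem_cat) (orbCA (w \in sk)). Qed.

Let not_bigger c' t1 t2 t3 t4 : spider c' t1 t2 t3 t4 ->
  spider_size t1 t2 t3 t4 = (spider_size si sj sk [::]).+1 -> False.
Proof. by move=> /maxS le e; move: le; rewrite e ltnn. Qed.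

Ltac size_solve def :=
  rewrite def /spider_size /=; do ?rewrite ?size_cat ?size_rev /=; clear; lia.

(** Each adjacency of [w] excluded here and below would allow a spider with one more vertex,
    contrary to [maxS]. *)
Lemma outside_center : ~~ G w c.
Proof.
by apply/negP => wc; apply: (not_bigger (extend_center S wS wc)); rewrite /spider_size /=; lia.
Qed.

Lemma outside_end : ~~ G w (last c si).
Proof.
apply/negP => wi; apply: (not_bigger (extend_end S wS wi)).
by rewrite /spider_size size_cat /=; lia.
Qed.

Lemma outside_rotate a u v b : si = a ++ u :: v :: b -> G (last c si) u -> ~~ G w v.
Proof.
move=> def iu; apply/negP => wv; move: S wS iu; rewrite def last_cat /=.
move=> S1 wS1 iu; apply: (not_bigger (extend_rotate S1 wS1 iu wv)); size_solve def.
Qed.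

Lemma outside_insert a u v b : si = a ++ u :: v :: b -> G w u -> ~~ G w v.
Proof.
move=> def wu; apply/negP => wv; move: S wS; rewrite def.
move=> S1 wS1; apply: (not_bigger (extend_insert S1 wS1 wu wv)); size_solve def.
Qed.

Lemma outside_cross a u v b : si = a ++ u :: v :: b -> G w u -> others2 v = 0.
Proof.
move=> def wu; rewrite /others2; apply/eqP; rewrite addn_eq0 !eqb0.
apply/andP; split; apply/negP => jv.
  move: S wS; rewrite def => S1 wS1.
  apply: (not_bigger (extend_cross S1 wS1 wu jv)); size_solve def.
move: S' wS'; rewrite def => S1 wS1.
apply: (not_bigger (extend_cross S1 wS1 wu jv)); size_solve def.
Qed.

Lemma outside_branch a u b : si = a ++ u :: b -> G w u -> others2 u = 0.
Proof.
move=> def wu; rewrite /others2; apply/eqP; rewrite addn_eq0 !eqb0.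
apply/andP; split; apply/negP => ju.
  move: S wS; rewrite def => S1 wS1.
  apply: (not_bigger (extend_branch S1 wS1 wu ju)); size_solve def.
move: S' wS'; rewrite def => S1 wS1.
apply: (not_bigger (extend_branch S1 wS1 wu ju)); size_solve def.
Qed.

Lemma outside_split a u b : si = a ++ u :: b -> G (last c si) c -> ~~ G w u.
Proof.
move=> def ic; apply/negP => wu; move: S wS ic; rewrite def last_cat adjC /=.
move=> S1 wS1 ic; apply: (not_bigger (extend_split S1 wS1 ic wu)); size_solve def.
Qed.

Lemma outside_split_other a u b d z e : si = a ++ u :: b -> sj = d ++ z :: e ->
  G (last c si) c -> others2 u = 2 -> ~~ G w z.
Proof.
move=> defi defj ic ou; apply/negP => wz.
have [ju ku] : G (last c sj) u /\ G (last c sk) u.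
  by move: ou; rewrite /others2; do 2!case: (G _ u).
move: S wS ic ju; rewrite defi defj !last_cat (adjC G _ c) /= => S1 wS1 ic ju.
apply: (not_bigger (extend_split_other S1 wS1 ic ju ku wz)).
rewrite defj; size_solve defi.
Qed.

Lemma others2_cycle a u d z e : si = a ++ u :: d ++ z :: e ->
  path G (last c si) d -> others2 u = 2 -> others2 z = 0.
Proof.
move=> def pd; rewrite /others2.
have := stuck_cycle S st def pd; have := stuck_cycle S' st' def pd.
case: (G _ u); case: (G _ u) => //.
by do 2?[case: (G _ z) => //=]; do ?[move=> /(_ isT) // | move=> _].
Qed.

Lemma others2_head y b : si = y :: b -> others2 y = 0.
Proof.
move=> def; rewrite /others2 (negPf (stuck_head S st def)).
by rewrite (negPf (stuck_head S' st' def)).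
Qed.

Lemma three_legs_count :
  \sum_(v <- si) (G (last c si) v + G w v + others2 v) < size si \/
  \sum_(v <- si) (G (last c si) v + G w v + others2 v) = size si /\
    (has (fun u => others2 u == 2) si \/
     exists v b, [/\ si = v :: b, G w v & G (last c si) v]).
Proof.
have psub a v d z e : si = a ++ v :: d ++ z :: e -> path G v d.
  by move=> def; case/and5P: S; rewrite def cat_path /= cat_path => /and4P[].
apply: (@leg_count _ si (G (last c si)) (G w) others2) => //.
- move=> a u v b def iu; rewrite (outside_rotate def iu); split=> //.
  rewrite /others2 (negPf (stuck_rotate S st def iu)).
  by rewrite (negPf (stuck_rotate S' st' def iu)).
- move=> a u v b def; rewrite /others2.
  have := stuck_cross S st def; have := stuck_cross S' st' def.
  case: (G _ u); case: (G _ u); case: (G _ v); case: (G _ v) => //=;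
  by do ?[move=> /(_ isT) // | move=> _].
- by move=> a u v b def wu; rewrite (outside_cross def wu) (outside_insert def wu).
- exact: outside_branch.
- by move=> a u b def; rewrite /others2; do 2!case: (G _ u).
- move=> a u b def ou iu z zb; case/splitPr: zb def => d e def.
  apply: (others2_cycle def) => //.
  case/lastP: a def => [|a p]; first by move=> /others2_head; rewrite ou.
  rewrite cat_rcons => def; apply: (alpha_cycle S st free j0 k0 def) => //;
    by move: ou; rewrite /others2; do 2!case: (G _ u).
- move=> a u v b def ou wv iv z zb; case/splitPr: zb def => d e def.
  apply: (@others2_cycle a u (v :: d) z e) => //=.
  by rewrite iv (psub (rcons a u) v d z e) // cat_rcons.
- move=> v b def wv iv z zb; case/splitPr: zb def => d e def.
  have pd : path G (last c si) (v :: d) by rewrite /= iv (psub [::] v d z e).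
  rewrite /others2 (negPf (stuck_cycle_leg S st (d := v :: d) def pd)).
  by rewrite (negPf (stuck_cycle_leg S' st' (d := v :: d) def pd)).
- exact: others2_head.
- move=> a x def; have e : last c si = x by rewrite def last_rcons.
  rewrite -e outside_end adj_irrefl /others2 !(adjC G _ (last c si)).
  by rewrite (negPf (stuck_ends S st)) (negPf (stuck_ends S' st')).
Qed.

End ThreeLegs.

(** * The degree bound for three legs *)

Section ThreeLegsBound.
Variables (V : finType) (G : sgraph V).
Implicit Types (c u v x y z : V) (s t a b : seq V).
Notation spider := (spider G).

Definition maximum n : Prop := forall c t1 t2 t3 t4,
  spider c t1 t2 t3 t4 -> spider_size t1 t2 t3 t4 <= n.

(** When the leg sum reaches its length and the end of [si] is adjacent to [c], the two splitting
    arguments and [outside_center] leave [w] without any neighbour on the spider. *)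
Lemma three_legs_leg c si sj sk w : spider c si sj sk [::] ->
  w \notin c :: si ++ sj ++ sk ++ [::] -> has (G w) (c :: si ++ sj ++ sk) ->
  stuck G [::] (spider_size si sj sk [::]) ->
  maximum (spider_size si sj sk [::]) ->
  star_free 5 G -> si <> [::] -> sj <> [::] -> sk <> [::] ->
  count (G (last c si)) si + count (G w) si + count (G (last c sj)) si +
  count (G (last c sk)) si + G (last c si) c <= size si.
Proof.
move=> S wS wz st maxS free i0 j0 k0.
have := three_legs_count S wS st maxS free i0 j0 k0.
rewrite /others2 !big_split /= !sum_nat_of_bool !addnA.
case=> [lt|[eq bad]].
  by apply: leq_trans lt; rewrite -addn1 leq_add2l leq_b1.
rewrite eq -[leqRHS]addn0 leq_add2l leqNgt lt0b; apply/negP => ic.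
case: bad => [/hasP[u ui /eqP ou]|[v [b [def wv iv]]]]; last first.
  by have := outside_split S wS maxS (a := [::]) def ic; rewrite wv.
have [a [b def]] : exists a b, si = a ++ u :: b by case/splitPr: ui => a b; exists a, b.
case/hasP: wz => z; rewrite inE !mem_cat => /predU1P[->|/or3P[] zs] wz.
- by have := outside_center S wS maxS; rewrite wz.
- have [d [e dz]] : exists d e, si = d ++ z :: e by case/splitPr: zs => d e; exists d, e.
  by have := outside_split S wS maxS dz ic; rewrite wz.
- have [d [e dz]] : exists d e, sj = d ++ z :: e by case/splitPr: zs => d e; exists d, e.
  by have := outside_split_other S wS maxS def dz ic ou; rewrite wz.
have [d [e dz]] : exists d e, sk = d ++ z :: e by case/splitPr: zs => d e; exists d, e.
have S' := spider_swap23 S.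
have wS' : w \notin c :: si ++ sk ++ sj ++ [::].
  by move: wS; rewrite !(inE, mem_cat) (orbCA (w \in sk)).
have maxS' : maximum (spider_size si sk sj [::]).
  by move: maxS; rewrite /spider_size (addnAC (size si)).
have ou' : others2 G c sk sj u = 2 by rewrite /others2 addnC.
by have := outside_split_other S' wS' maxS' def dz ic ou'; rewrite wz.
Qed.

Lemma three_legs_bound c s1 s2 s3 w : spider c s1 s2 s3 [::] ->
  let p := c :: s1 ++ s2 ++ s3 in
  w \notin p -> has (G w) p ->
  stuck G [::] (spider_size s1 s2 s3 [::]) ->
  maximum (spider_size s1 s2 s3 [::]) -> star_free 5 G ->
  [/\ pairwise (nonadj G) [:: last c s1; last c s2; last c s3; w],
      uniq [:: last c s1; last c s2; last c s3; w] &
  count (G (last c s1)) p + count (G (last c s2)) p +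
  count (G (last c s3)) p + count (G w) p < size p].
Proof.
move=> S p wp wz st maxS free.
have sizes t1 t2 t3 : spider c t1 t2 t3 [::] -> spider_size t1 t2 t3 [::] =
    spider_size s1 s2 s3 [::] -> [/\ t1 <> [::], t2 <> [::] & t3 <> [::]].
  move=> St e; split=> t0; move: St e; rewrite t0 => St e.
  - apply: (st _ _ _ (spider_swap23 (spider_swap12 St))).
    by rewrite -e /spider_size /=; lia.
  - apply: (st _ _ _ (spider_swap23 St)).
    by rewrite -e /spider_size /=; lia.
  - by apply: (st _ _ _ St); rewrite -e.
have [n1 n2 n3] := sizes _ _ _ S erefl.
have S2 := spider_swap12 S; have S3 := spider_swap12 (spider_swap23 S).
have e2 : spider_size s2 s1 s3 [::] = spider_size s1 s2 s3 [::] by rewrite /spider_size; lia.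
have e3 : spider_size s3 s1 s2 [::] = spider_size s1 s2 s3 [::] by rewrite /spider_size; lia.
have w1 : w \notin c :: s1 ++ s2 ++ s3 ++ [::] by rewrite cats0.
have w2 : w \notin c :: s2 ++ s1 ++ s3 ++ [::].
  by move: w1; rewrite !(inE, mem_cat) !negb_or => /and5P[-> -> -> -> _].
have w3 : w \notin c :: s3 ++ s1 ++ s2 ++ [::].
  by move: w1; rewrite !(inE, mem_cat) !negb_or => /and5P[-> -> -> -> _].
have z2 : has (G w) (c :: s2 ++ s1 ++ s3).
  by move: wz; rewrite /= !has_cat (orbCA (has _ s2)).
have z3 : has (G w) (c :: s3 ++ s1 ++ s2).
  by move: wz; rewrite /= !has_cat (orbC (has _ s3)) -orbA.
have m2 : maximum (spider_size s2 s1 s3 [::]) by rewrite e2.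
have m3 : maximum (spider_size s3 s1 s2 [::]) by rewrite e3.
have st2 : stuck G [::] (spider_size s2 s1 s3 [::]) by rewrite e2.
have st3 : stuck G [::] (spider_size s3 s1 s2 [::]) by rewrite e3.
split.
- rewrite /= /nonadj (stuck_ends S st).
  have -> : ~~ G (last c s1) (last c s3).
    apply: (@stuck_ends _ _ c s1 s3 s2 [::]); first exact: spider_swap23.
    by move: st; rewrite /spider_size (addnAC (size s1)).
  have -> : ~~ G (last c s2) (last c s3).
    apply: (@stuck_ends _ _ c s2 s3 s1 [::]); first exact: spider_swap23.
    by move: st2; rewrite /spider_size (addnAC (size s2)).
  rewrite !(adjC G _ w) (outside_end S w1 maxS) (outside_end S2 w2 m2).
  by rewrite (outside_end S3 w3 m3).
- have U := spider_uniq S; move: U w1.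
  case/lastP: (s1) n1 => // t1 x1 _; case/lastP: (s2) n2 => // t2 x2 _.
  case/lastP: (s3) n3 => // t3 x3 _; rewrite !last_rcons => U wU.
  suff : uniq ([:: x1; x2; x3; w] ++ c :: t1 ++ t2 ++ t3).
    by rewrite cat_uniq => /andP[].
  have {wU}U : uniq (w :: c :: rcons t1 x1 ++ rcons t2 x2 ++ rcons t3 x3 ++ [::]).
    by rewrite cons_uniq wU.
  by clear -U; apply: uniq_of_perm U; perm_solve.
have L1 := three_legs_leg S w1 wz st maxS free n1 n2 n3.
have L2 := three_legs_leg S2 w2 z2 st2 m2 free n2 n1 n3.
have L3 := three_legs_leg S3 w3 z3 st3 m3 free n3 n1 n2.
have wc := outside_center S w1 maxS.
(* The adjacencies of the ends to the centre are already paid for in the leg bounds, and [w] is not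
   adjacent to the centre. *)
rewrite /p /= !count_cat !size_cat (negPf wc).
move: L1 L2 L3; clear.
by do 3!move: (nat_of_bool _) => ?; lia.
Qed.

End ThreeLegsBound.

(** * Spanning spiders *)

Lemma bounded_max (P : nat -> Prop) (b : nat) :
  (exists n, P n) -> (forall n, P n -> n <= b) ->
  exists2 n, P n & forall m, P m -> m <= n.
Proof.
move=> [n0 Pn0]; elim: b => [|b IH] Pb.
  by exists n0 => // m Pm; apply: leq_trans (Pb m Pm) _.
have [Pb1|nPb1] := classic (P b.+1); first by exists b.+1.
apply: IH => n Pn; have := Pb _ Pn; rewrite leq_eqVlt => /predU1P[en|//].
by case: nPb1; rewrite -en.
Qed.

Section SpanningSpider.
Variables (V : finType) (G : sgraph V).
Implicit Types (c u v w x y z : V) (s t a b : seq V).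
Notation spider := (spider G).
Hypothesis conG : connected G.

(** Otherwise the vertices of [c :: p] are closed under adjacency, and connectedness makes them all
    of [V]. *)
Lemma exists_outside_neighbour c p : uniq (c :: p) -> size (c :: p) < #|V| ->
  exists2 w, w \notin c :: p & has (G w) (c :: p).
Proof.
move=> U lt; case: (pickP [pred w | (w \notin c :: p) && has (G w) (c :: p)]).
  by move=> w /andP[? ?]; exists w.
move=> none; have out w y : w \notin c :: p -> y \in c :: p -> ~~ G w y.
  move=> wp yp; have := none w; rewrite [RHS]/= in wp *; rewrite inE wp.
  by move=> /negbT/hasPn/(_ y yp).
have cl : closed G (mem (c :: p)).
  move=> x y xy; rewrite -!topredE /=; apply/idP/idP => [xp|yp].
    by apply/negPn/negP => yp; have := out _ _ yp xp; rewrite adjC xy.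
  by apply/negPn/negP => xp; have := out _ _ xp yp; rewrite xy.
have all_in x : x \in c :: p.
  have : (c \in c :: p) = (x \in c :: p) := closed_connect cl (conG.2 c x).
  by rewrite mem_head => <-.
move: lt; rewrite -(card_uniqP U) => lt; move: (lt).
by rewrite (eq_card (B := V)) ?ltnn // => x; rewrite all_in.
Qed.

Lemma spider_size_verts c s1 s2 s3 s4 : size (c :: s1 ++ s2 ++ s3 ++ s4) =
  spider_size s1 s2 s3 s4.
Proof. by rewrite /= !size_cat !addnA. Qed.

Lemma spider_size_le c s1 s2 s3 s4 : spider c s1 s2 s3 s4 ->
  spider_size s1 s2 s3 s4 <= #|V|.
Proof.
by move=> /spider_uniq U; rewrite -(spider_size_verts c) -(card_uniqP U) max_card.
Qed.

(** A spider with two legs is a path, and any outside neighbour can be hung from it by moving the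
    centre to the point of attachment. *)
Lemma maximum_stuck n : maximum G n -> n < #|V| -> stuck G [::] n.
Proof.
move=> maxn ltn c t1 t2 S e.
have [w wS /hasP[z zS wz]] : exists2 w, w \notin c :: t1 ++ t2 ++ [::] ++ [::] &
    has (G w) (c :: t1 ++ t2 ++ [::] ++ [::]).
  apply: exists_outside_neighbour (spider_uniq S) _.
  by rewrite spider_size_verts e.
have big c' r1 r2 r3 r4 : spider c' r1 r2 r3 r4 ->
    spider_size r1 r2 r3 r4 = n.+1 -> False.
  by move=> /maxn le e'; move: le; rewrite e' ltnn.
move: zS; rewrite !(inE, mem_cat) orbF => /or3P[/eqP zc|zt|zt].
- rewrite {}zc in wz; apply: big (extend_center S wS wz) _.
  by rewrite -e /spider_size /=; lia.
- case/splitPr: zt S wS e => a b S wS e.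
  apply: big (extend_path S wS wz) _.
  by rewrite -e /spider_size !size_cat size_rev /=; lia.
case/splitPr: zt S wS e => a b S wS e.
have wS' : w \notin c :: (a ++ z :: b) ++ t1 ++ [::] ++ [::].
  by move: wS; rewrite !(inE, mem_cat) !negb_or => /and4P[-> -> -> _].
apply: big (extend_path (spider_swap12 S) wS' wz) _.
by rewrite -e /spider_size !size_cat size_rev /=; lia.
Qed.

Lemma degree_end n c s1 s2 s3 s4 : maximum G n -> spider c s1 s2 s3 s4 ->
  spider_size s1 s2 s3 s4 = n ->
  degree G (last c s1) <= count (G (last c s1)) (c :: s1 ++ s2 ++ s3 ++ s4).
Proof.
move=> maxn S e; apply: degree_le_count => v xv; apply/negPn/negP => vS.
have := extend_end S vS; rewrite adjC => /(_ xv)/maxn.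
by rewrite -e /spider_size size_cat /=; lia.
Qed.

Hypothesis free : star_free 5 G.
Hypothesis deg : leq_inf (#|V| - 1) (sigma G 4).

Lemma spanning_spider : exists c s1 s2 s3 s4,
  spider c s1 s2 s3 s4 /\ spider_size s1 s2 s3 s4 = #|V|.
Proof.
pose P n := exists c s1 s2 s3 s4, spider c s1 s2 s3 s4 /\ spider_size s1 s2 s3 s4 = n.
have [|n [c [s1 [s2 [s3 [s4 [S]]]]]] en|n Pn maxP] := @bounded_max P #|V|.
- have /card_gt0P[c _] := conG.1.
  by exists 1, c, [::], [::], [::], [::].
- by rewrite -en; exact: spider_size_le S.
have maxn : maximum G n.
  by move=> c t1 t2 t3 t4 S; apply: maxP; exists c, t1, t2, t3, t4.
case: (ltngtP n #|V|) => [ltn|gtn|<- //]; last first.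
  by case: Pn gtn => c [s1 [s2 [s3 [s4 [S <-]]]]]; rewrite ltnNge (spider_size_le S).
exfalso.
have cnt c s1 s2 s3 s4 t1 t2 t3 t4 x : perm_eq (c :: t1 ++ t2 ++ t3 ++ t4)
   (c :: s1 ++ s2 ++ s3 ++ s4) ->
   count (G x) (c :: t1 ++ t2 ++ t3 ++ t4) = count (G x) (c :: s1 ++ s2 ++ s3 ++ s4).
  by move/permP.
(* Reordering the legs puts any chosen end on the first leg, where [degree_end] applies. *)
have degE c s1 s2 s3 s4 t1 t2 t3 t4 : spider c s1 s2 s3 s4 ->
    spider_size s1 s2 s3 s4 = n -> spider c t1 t2 t3 t4 ->
    perm_eq (c :: t1 ++ t2 ++ t3 ++ t4) (c :: s1 ++ s2 ++ s3 ++ s4) ->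
    degree G (last c t1) <= count (G (last c t1)) (c :: s1 ++ s2 ++ s3 ++ s4).
  move=> S e St p; rewrite -(cnt _ _ _ _ _ _ _ _ _ _ p).
  apply: degree_end maxn St _.
  by rewrite -(spider_size_verts c) (perm_size p) spider_size_verts.
have [[c [s1 [s2 [s3 [S e]]]]]|irr] := classic (exists c s1 s2 s3,
    spider c s1 s2 s3 [::] /\ spider_size s1 s2 s3 [::] = n).
  have st : stuck G [::] n by exact: maximum_stuck.
  have U := spider_uniq S.
  have ltS : size (c :: s1 ++ s2 ++ s3 ++ [::]) < #|V| by rewrite spider_size_verts e.
  have [w wS wz] := exists_outside_neighbour U ltS.
  have degw := degree_lt_count G U wS.
  have d1 := degE _ _ _ _ _ _ _ _ _ S e S (perm_refl _).
  have d2 := degE _ _ _ _ _ _ _ _ _ S e (spider_swap12 S) ltac:(perm_solve).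
  have d3 := degE _ _ _ _ _ _ _ _ _ S e (spider_swap12 (spider_swap23 S)) ltac:(perm_solve).
  rewrite !cats0 in wS wz degw d1 d2 d3.
  rewrite -e in st maxn; have [ind Ux lt] := three_legs_bound S wS wz st maxn free.
  (* The strict bounds on the spider and on the degree of [w] each save one, so the degree sum is at
     most [#|V| - 2]. *)
  have := degree_sum_four deg Ux ind.
  move: degw d1 d2 d3 lt; clear; lia.
(* Among all maximum spiders, one with the longest possible first leg is chosen. *)
pose Q l := exists c s1 s2 s3 s4,
  [/\ spider c s1 s2 s3 s4, spider_size s1 s2 s3 s4 = n & size s1 = l].
have [|l [c [s1 [s2 [s3 [s4 [S e <-]]]]]]|l [c [s1 [s2 [s3 [s4 [S e el]]]]]] maxl] :=
    @bounded_max Q n.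
- by case: Pn => c [s1 [s2 [s3 [s4 [S e]]]]]; exists (size s1), c, s1, s2, s3, s4.
- by rewrite -e /spider_size; lia.
have irrn : irreducible G (spider_size s1 s2 s3 s4).
  by move=> c' t1 t2 t3 St et; apply: irr; exists c', t1, t2, t3; rewrite -e.
have longest c' t1 t2 t3 t4 : spider c' t1 t2 t3 t4 ->
    spider_size t1 t2 t3 t4 = spider_size s1 s2 s3 s4 -> size t1 <= size s1.
  by move=> St et; rewrite el; apply: maxl; exists c', t1, t2, t3, t4; rewrite et e.
have [ind Ux lt] := four_legs_bound S irrn free longest.
have d1 := degE _ _ _ _ _ _ _ _ _ S e S (perm_refl _).
have d2 := degE _ _ _ _ _ _ _ _ _ S e (spider_swap12 S) ltac:(perm_solve).
have d3 := degE _ _ _ _ _ _ _ _ _ S e (spider_swap12 (spider_swap23 S)) ltac:(perm_solve).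
have d4 := degE _ _ _ _ _ _ _ _ _ S e
  (spider_swap12 (spider_swap23 (spider_swap34 S))) ltac:(perm_solve).
have := degree_sum_four deg Ux ind.
have := spider_size_verts c s1 s2 s3 s4; rewrite e.
(* The degree sum is below [n], which is itself below [#|V|]. *)
move: d1 d2 d3 d4 lt ltn; clear; lia.
Qed.

End SpanningSpider.

Theorem theorem1p7 (V : finType) (G : sgraph V) :
  connected G ->
  star_free 5 G ->
  leq_inf (#|V| - 1) (sigma G 4) ->
  exists T : sgraph V,
    spanning_tree G T /\ #|leaves T| + #|branch_vertices T| <= 5.
Proof.
move=> conG free deg.
have [c [s1 [s2 [s3 [s4 [S span]]]]]] := spanning_spider conG free deg.
exact: spider_spanning_tree S span.
Qed.
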